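(* Let $\mathcal{L}=(\bm{X},\bm{E},\bm{F},\mathbb{P}_{\bm{E}})$ and $\mathcal{H}=(\bm{Y},\bm{U},\bm{G},\mathbb{P}_{\bm{U}})$ be structural causal models with sets of admissible (soft) interventions $\mathcal{I}$ and $\mathcal{J}$, and suppose that $\mathcal{H}$ is a soft $\tau$-abstraction of $\mathcal{L}$ with intervention map $\omega\colon\mathcal{I}\to\mathcal{J}$. Then: (a) Let $\tilde{\mathcal{J}}\subseteq\mathcal{J}$ be the subset of admissible high-level hard interventions and $\tilde{\mathcal{I}}=\{i\in\mathcal{I}\mid\omega(i)\in\tilde{\mathcal{J}}\}$. With $\tilde{\mathcal{I}},\tilde{\mathcal{J}}$ as the sets of admissible interventions, $\mathcal{H}$ is a low soft $\tau$-abstraction of $\mathcal{L}$. (b) Let $\tilde{\mathcal{I}}=\{i\in\mathcal{I}\mid i\text{ is hard and }\omega(i)\text{ is hard}\}$ and $\tilde{\mathcal{J}}=\{\omega(i)\mid i\in\tilde{\mathcal{I}}\}$. With $\tilde{\mathcal{I}},\tilde{\mathcal{J}}$ as the sets of admissible hard interventions, $\mathcal{H}$ is a $\tau$-abstraction of $\mathcal{L}$.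
   Context: Each variable $V$ has a domain $\mathrm{Val}(V)$; for a set $\bm{V}$ of variables, $\mathrm{Val}(\bm{V})=\prod_{V\in\bm{V}}\mathrm{Val}(V)$. For $\bm{V}\subseteq\bm{X}$ and $\bm{x}\in\mathrm{Val}(\bm{X})$, $\mathrm{Proj}(\bm{x},\bm{V})\in\mathrm{Val}(\bm{V})$ is the restriction of $\bm{x}$ to the variables $\bm{V}$. A structural causal model (SCM) is a tuple $\mathcal{M}=(\bm{X},\bm{E},\bm{F},\mathbb{P}_{\bm{E}})$ with endogenous variables $\bm{X}$, exogenous variables $\bm{E}$, a family $\bm{F}$ of structural equations $F_X\colon\mathrm{Val}(\bm{X})\times\mathrm{Val}(\bm{E})\to\mathrm{Val}(X)$, $X\in\bm{X}$, and a probability measure $\mathbb{P}_{\bm{E}}$ on $\mathrm{Val}(\bm{E})$. $F_X$ depends only on a subset $\mathrm{Pa}(X)\subseteq\bm{X}\cup\bm{E}$ of variables, the parents of $X$. Standing assumption, for every SCM including every one produced by an intervention: endogenous settings are fully determined by exogenous settings, so for each $\bm{e}\in\mathrm{Val}(\bm{E})$ there is a unique $\bm{x}\in\mathrm{Val}(\bm{X})$ with $\bm{x}=(F_X(\bm{x},\bm{e}))_{X\in\bm{X}}$; write $\mathcal{M}(\bm{e})=\bm{x}$. A soft intervention $i=(\bm{V}\gets\bm{f})$ on $\mathcal{M}$, with $\bm{V}\subseteq\bm{X}$ and $\bm{f}=(f_X)_{X\in\bm{V}}$, $f_X\colon\mathrm{Val}(\bm{X})\times\mathrm{Val}(\bm{E})\to\mathrm{Val}(X)$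 depending at most on $\mathrm{Pa}(X)$, produces the SCM $\mathcal{M}_i=(\bm{X},\bm{E},\bm{F}^i,\mathbb{P}_{\bm{E}})$ with $F^i_X=f_X$ if $X\in\bm{V}$ and $F^i_X=F_X$ otherwise. A hard intervention $(\bm{V}\gets\bm{v})$, $\bm{v}\in\mathrm{Val}(\bm{V})$, is the special case where each $f_X$ is the constant $\mathrm{Proj}(\bm{v},X)$. The restriction set of a hard intervention $i=(\bm{V}\gets\bm{v})$ is $\mathrm{Rst}(\mathcal{M}_i)=\{\bm{x}\in\mathrm{Val}(\bm{X})\mid\mathrm{Proj}(\bm{x},\bm{V})=\bm{v}\}$. The soft restriction set of $i=(\bm{V}\gets\bm{f})$, viewing $\bm{f}$ as a joint function $\mathrm{Val}(\bm{X})\times\mathrm{Val}(\bm{E})\to\mathrm{Val}(\bm{V})$, is $\mathrm{SoftRst}(\mathcal{M}_i)=\{\bm{x}\in\mathrm{Val}(\bm{X})\mid\mathrm{Proj}(\bm{x},\bm{V})\in\mathrm{Image}(\bm{f})\}$. The family $\bm{F}^i$ is also viewed as a joint function $\mathrm{Val}(\bm{X})\times\mathrm{Val}(\bm{E})\to\mathrm{Val}(\bm{X})$. Throughout, $\tau_{\bm{Y}}\colon\mathrm{Val}(\bm{X})\to\mathrm{Val}(\bm{Y})$ and $\tau_{\bm{U}}\colon\mathrm{Val}(\bm{E})\to\mathrm{Val}(\bm{U})$ are surjective, and $\mathcal{I},\mathcal{J}$ are the sets of admissible interventions of $\mathcal{L},\mathcal{H}$. Soft abstraction: $\mathcal{H}$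 is a soft $\tau$-abstraction of $\mathcal{L}$ if there is a surjective $\omega\colon\mathcal{I}\to\mathcal{J}$ (the intervention map) such that for every $i\in\mathcal{I}$: (S) $\mathrm{SoftRst}(\mathcal{H}_{\omega(i)})=\{\tau_{\bm{Y}}(\bm{x})\mid\bm{x}\in\mathrm{SoftRst}(\mathcal{L}_i)\}$, and for all $\bm{e}\in\mathrm{Val}(\bm{E})$, $\bm{x}\in\mathrm{Val}(\bm{X})$, $\tau_{\bm{Y}}(\bm{F}^i(\bm{x},\bm{e}))=\bm{G}^{\omega(i)}(\tau_{\bm{Y}}(\bm{x}),\tau_{\bm{U}}(\bm{e}))$. Low soft abstraction: $\mathcal{H}$ is a low soft $\tau$-abstraction of $\mathcal{L}$ if there is a surjective $\omega\colon\mathcal{I}\to\mathcal{J}$ such that for every $i\in\mathcal{I}$, (S) holds and $\tau_{\bm{Y}}(\mathcal{L}_i(\bm{e}))=\mathcal{H}_{\omega(i)}(\tau_{\bm{U}}(\bm{e}))$ for all $\bm{e}\in\mathrm{Val}(\bm{E})$. $\tau$-abstraction (for sets $\mathcal{I},\mathcal{J}$ of hard interventions): let $\omega\colon\mathcal{I}\to\mathcal{J}$ be the partial function defined at $i$ whenever there is $\omega(i)\in\mathcal{J}$ with $\mathrm{Rst}(\mathcal{H}_{\omega(i)})=\{\tau_{\bm{Y}}(\bm{x})\mid\bm{x}\in\mathrm{Rst}(\mathcal{L}_i)\}$ (interventions yielding the same structural equations are not regarded as distinct). $\mathcal{H}$ is a $\tau$-abstraction of $\mathcal{L}$ if $\omega$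 is surjective and, for every $i\in\mathcal{I}$ at which $\omega$ is defined and every $\bm{e}\in\mathrm{Val}(\bm{E})$, $\tau_{\bm{Y}}(\mathcal{L}_i(\bm{e}))=\mathcal{H}_{\omega(i)}(\tau_{\bm{U}}(\bm{e}))$. *)

(* Defs.v *)
From HB Require Import structures.
From mathcomp Require Import all_boot all_order all_algebra.
From mathcomp Require Import all_classical all_reals all_analysis.

Set Implicit Arguments.
Unset Strict Implicit.
Unset Printing Implicit Defensive.

Local Open Scope classical_set_scope.

(** [Val(V)] is [forall v : V, D v] for the full set of variables, and
    [val_on D A] for a subset [A]. *)
Definition val_on (V : Type) (D : V -> Type) (A : set V) : Type :=
  forall v : V, A v -> D v.

Definition Proj (V : Type) (D : V -> Type) (x : forall v, D v) (A : set V) :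
    val_on D A :=
  fun v _ => x v.
Arguments Proj {V D} x A.

Definition depends_only_on (X E : Type) (DX : X -> Type) (DE : E -> Type)
    (T : Type) (P : set (X + E))
    (f : (forall v, DX v) -> (forall v, DE v) -> T) : Prop :=
  forall x x' e e',
    (forall v, P (inl v) -> x v = x' v) ->
    (forall v, P (inr v) -> e v = e' v) ->
    f x e = f x' e'.

(** Exactly one setting [x] solves [x = F(x, e)], for each [e]. *)
Definition uniquely_solvable (X E : Type) (DX : X -> Type) (DE : E -> Type)
    (F : forall v, (forall w, DX w) -> (forall w, DE w) -> DX v) : Prop :=
  forall e, exists! x : (forall v, DX v), x = (fun v => F v x e).

(** The sigma-algebra of [Val(E)] is left arbitrary: it is the one generated by
    [events], and every sigma-algebra is generated by itself.  Exogenous domains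
    are pointed because measurable types are; this loses nothing, since a
    probability measure on a product forces all its factors to be nonempty. *)
Record scm (R : realType) := SCM {
  endo : Type;
  exo : Type;
  endo_dom : endo -> Type;
  exo_dom : exo -> pointedType;
  pa : endo -> set (endo + exo);
  struct_eqn : forall X : endo,
    (forall v, endo_dom v) -> (forall v, exo_dom v) -> endo_dom X;
  events : set (set (forall v, exo_dom v));
  prob : probability (g_sigma_algebraType events) R;
  struct_eqn_pa : forall X, depends_only_on (pa X) (struct_eqn X);
  struct_eqn_solvable : uniquely_solvable struct_eqn
}.

Definition endo_val (R : realType) (M : scm R) : Type :=
  forall v : endo M, endo_dom v.
Definition exo_val (R : realType) (M : scm R) : Type :=
  forall v : exo M, exo_dom v.

Definition joint_eqn (R : realType) (M : scm R) (x : endo_val M)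
    (e : exo_val M) : endo_val M :=
  fun X => struct_eqn X x e.
Arguments joint_eqn {R} M x e.

Definition solution (R : realType) (M : scm R) (e : exo_val M) : endo_val M :=
  sval (cid (struct_eqn_solvable e)).
Arguments solution {R} M e.

Definition replace_eqn (R : realType) (M : scm R) (V : set (endo M))
    (f : forall X, V X -> endo_val M -> exo_val M -> endo_dom X) (X : endo M)
    (x : endo_val M) (e : exo_val M) : endo_dom X :=
  match pselect (V X) with
  | left VX => f X VX x e
  | right _ => struct_eqn X x e
  end.

(** Soft interventions [(V <- f)].  The standing assumption that every
    intervened model is uniquely solvable is part of the structure. *)
Record intervention (R : realType) (M : scm R) := Intervention {
  target : set (endo M);
  ifun : forall X, target X -> endo_val M -> exo_val M -> endo_dom X;
  ifun_pa : forall X (VX : target X), depends_only_on (pa X) (ifun VX);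
  ifun_solvable : uniquely_solvable (replace_eqn ifun)
}.

Lemma replace_eqn_pa (R : realType) (M : scm R) (i : intervention M)
    (X : endo M) :
  depends_only_on (pa X) (replace_eqn (@ifun R M i) X).
Proof.
rewrite /replace_eqn; case: (pselect _) => [VX|_].
- exact: ifun_pa.
- exact: struct_eqn_pa.
Qed.

Definition intervene (R : realType) (M : scm R) (i : intervention M) : scm R :=
  SCM (prob M) (replace_eqn_pa i) (ifun_solvable i).

Definition joint_ifun (R : realType) (M : scm R) (i : intervention M)
    (x : endo_val M) (e : exo_val M) : val_on (@endo_dom R M) (target i) :=
  fun X VX => ifun VX x e.
Arguments joint_ifun {R M} i x e.

Definition soft_rst (R : realType) (M : scm R) (i : intervention M) :
    set (endo_val M) :=
  [set x | exists x' e', Proj x (target i) = joint_ifun i x' e'].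

(** [i] is the hard intervention [(V <- v)], with [V = target i]. *)
Definition hard_with (R : realType) (M : scm R) (i : intervention M)
    (v : val_on (@endo_dom R M) (target i)) : Prop :=
  forall x e, joint_ifun i x e = v.
Arguments hard_with {R M} i v.

Definition is_hard (R : realType) (M : scm R) (i : intervention M) : Prop :=
  exists v, hard_with i v.

(** For a hard [i] the value [v] is unique, as [Val(X)] and [Val(E)] are
    nonempty; for any other [i] this set is empty and is never used. *)
Definition rst (R : realType) (M : scm R) (i : intervention M) :
    set (endo_val M) :=
  [set x | exists2 v, hard_with i v & Proj x (target i) = v].

Definition same_equations (R : realType) (M : scm R) (i j : intervention M) :
    Prop :=
  forall (x : endo_val M) (e : exo_val M),
    joint_eqn (intervene i) x e = joint_eqn (intervene j) x e.

Section Abstraction.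
Variables (R : realType) (L H : scm R).
Variables (tauY : endo_val L -> endo_val H) (tauU : exo_val L -> exo_val H).
Variables (I : set (intervention L)) (J : set (intervention H)).

(** A map [I -> J] is given by a total function sending [I] into [J]; there is
    always one extending it, by the intervention with empty target. *)
Definition soft_abstraction_by (omega : intervention L -> intervention H) :
    Prop :=
  [/\ set_fun I J omega, set_surj I J omega &
      forall i, I i ->
        soft_rst (omega i) = tauY @` soft_rst i /\
        forall (e : exo_val L) (x : endo_val L),
          tauY (joint_eqn (intervene i) x e) =
          joint_eqn (intervene (omega i)) (tauY x) (tauU e)].

Definition low_soft_abstraction : Prop :=
  exists omega : intervention L -> intervention H,
  [/\ set_fun I J omega, set_surj I J omega &
      forall i, I i ->
        soft_rst (omega i) = tauY @` soft_rst i /\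
        forall e : exo_val L,
          tauY (solution (intervene i) e) =
          solution (intervene (omega i)) (tauU e)].

(** The graph of the partial function omega of a tau-abstraction. *)
Definition omega_graph (i : intervention L) (j : intervention H) : Prop :=
  [/\ I i, J j & rst j = tauY @` rst i].

(** [omega_graph] is a partial function up to identifying interventions that
    yield the same equations: distinct hard interventions can have the same
    restriction set when some endogenous domain is a singleton. *)
Definition tau_abstraction : Prop :=
  [/\ I `<=` @is_hard R L, J `<=` @is_hard R H,
      forall i j j', omega_graph i j -> omega_graph i j' -> same_equations j j',
      forall j, J j -> exists i, omega_graph i j &
      forall i j, omega_graph i j -> forall e : exo_val L,
        tauY (solution (intervene i) e) =
        solution (intervene j) (tauU e)].

End Abstraction.

(* Main.v *)
(* Since tau intertwines the joint structural equations, it maps the solution of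
   the low-level model to a solution of the high-level one, and solutions are
   unique.  For hard interventions soft restriction sets are restriction sets,
   and a restriction set determines the intervened equations. *)

Require Import Defs.
From mathcomp Require Import all_boot all_order all_algebra.
From mathcomp Require Import all_classical all_reals all_analysis.

Local Open Scope classical_set_scope.

Lemma solution_fixpoint (R : realType) (M : scm R) (e : exo_val M) :
  solution M e = joint_eqn M (solution M e) e.
Proof. by rewrite /solution; case: cid => x [/= xE _]. Qed.

Lemma solution_unique (R : realType) (M : scm R) (e : exo_val M)
    (x : endo_val M) :
  x = joint_eqn M x e -> solution M e = x.
Proof. by rewrite /solution; case: cid => y [/= _ y_uniq] /y_uniq. Qed.

(** [u] is arbitrary and not tied to [tauU], so the lemma also compares two interventions on one
    model, with [id] as the map. *)
Lemma solution_commutes (R : realType) (L H : scm R)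
    (tauY : endo_val L -> endo_val H) (e : exo_val L) (u : exo_val H) :
  (forall x, tauY (joint_eqn L x e) = joint_eqn H (tauY x) u) ->
  tauY (solution L e) = solution H u.
Proof.
move=> tauE; apply/esym/solution_unique.
by rewrite -tauE -solution_fixpoint.
Qed.

Lemma same_equations_solution (R : realType) (M : scm R)
    (i j : intervention M) (e : exo_val M) :
  same_equations i j -> solution (intervene i) e = solution (intervene j) e.
Proof.
move=> ij; exact: (solution_commutes _ (intervene i) (intervene j) id e e).
Qed.

Lemma soft_rst_hard (R : realType) (M : scm R) (i : intervention M) :
  is_hard i -> soft_rst i = rst i.
Proof.
move=> [v iv]; apply/seteqP; split=> x /=.
- by move=> [x' [e' xE]]; exists v; rewrite // xE.
(* The joint function is constant, so any arguments attain its value; [point] supplies an exogenous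
   setting. *)
- by move=> [w iw xE]; exists x, (fun=> point); rewrite xE iw.
Qed.

Lemma joint_eqn_target (R : realType) (M : scm R) (i : intervention M)
    (x : endo_val M) (e : exo_val M) :
  Proj (joint_eqn (intervene i) x e) (target i) = joint_ifun i x e.
Proof.
apply: functional_extensionality_dep => X.
apply: functional_extensionality_dep => VX.
rewrite /Proj /joint_eqn /= /replace_eqn /joint_ifun.
(* The membership proof picked by [pselect] need not be [VX] syntactically. *)
by case: pselect => // VX'; rewrite (Prop_irrelevance VX' VX).
Qed.

Lemma joint_eqn_soft_rst (R : realType) (M : scm R) (i : intervention M)
    (x : endo_val M) (e : exo_val M) :
  soft_rst i (joint_eqn (intervene i) x e).
Proof. by exists x, e; exact: joint_eqn_target. Qed.

Lemma rst_target (R : realType) (M : scm R) (i : intervention M)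
    (x y : endo_val M) (X : endo M) :
  rst i x -> rst i y -> target i X -> x X = y X.
Proof.
move=> [v iv xE] [w iw yE] VX.
(* Both are the constant value of the same joint function, read off at one input. *)
have vw : v = w by rewrite -(iv x (fun=> point)) iw.
have : Proj x (target i) = Proj y (target i) by rewrite xE yE.
by move/(congr1 (fun p => p X VX)).
Qed.

(* For every [(x, e)] both joint equations take values in the common
   restriction set, so they agree on both targets. *)
Lemma eq_rst_same_equations (R : realType) (M : scm R)
    (i j : intervention M) :
  is_hard i -> is_hard j -> rst i = rst j -> same_equations i j.
Proof.
move=> hi hj ij x e.
have := joint_eqn_soft_rst _ _ i x e; rewrite soft_rst_hard // => ri.
have := joint_eqn_soft_rst _ _ j x e; rewrite soft_rst_hard // => rj.
apply: functional_extensionality_dep => X.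
have [iX|niX] := pselect (target i X).
  by apply: rst_target ri _ iX; rewrite ij.
have [jX|njX] := pselect (target j X).
  by apply: rst_target _ rj jX; rewrite -ij.
(* Outside both targets, each model keeps the original equation of [X]. *)
rewrite /joint_eqn /= /replace_eqn.
by case: pselect => // ?; case: pselect.
Qed.

Theorem mainTheorem5 (R : realType) (L H : scm R)
  (tauY : endo_val L -> endo_val H) (tauU : exo_val L -> exo_val H)
  (tauY_surj : set_surj [set: endo_val L] [set: endo_val H] tauY)
  (tauU_surj : set_surj [set: exo_val L] [set: exo_val H] tauU)
  (I : set (intervention L)) (J : set (intervention H))
  (omega : intervention L -> intervention H)
  (omega_soft : soft_abstraction_by tauY tauU I J omega) :
  (let J' := [set j | J j /\ is_hard j] in
   let I' := [set i | I i /\ J' (omega i)] in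
   low_soft_abstraction tauY tauU I' J') /\
  (let I' := [set i | [/\ I i, is_hard i & is_hard (omega i)]] in
   let J' := omega @` I' in
   tau_abstraction tauY tauU I' J').
Proof.
have [_ omega_surj omegaP] := omega_soft.
have sol i e : I i -> tauY (solution (intervene i) e) =
    solution (intervene (omega i)) (tauU e).
  move=> /omegaP[_ comm].
  exact: (solution_commutes _ (intervene i) (intervene (omega i))).
split=> [J' I'|I' J'].
  exists omega; split=> [i []//|j J'j|i [Ii _]].
    (* [I'] is the full preimage of [J'] in [I], so surjectivity is inherited. *)
    by have [i Ii ij] := omega_surj j J'j.1; exists i; rewrite // /I' /= ij.
  by split=> [|e]; [case: (omegaP i Ii)|exact: sol].
have J'_hard j : J' j -> is_hard j by move=> [i [_ _ hj] <-].
have eqJ' i j j' : omega_graph tauY I' J' i j -> omega_graph tauY I' J' i j' ->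
    same_equations j j'.
  move=> [_ Jj jE] [_ Jj' j'E].
  by apply: eq_rst_same_equations; [exact: J'_hard..|rewrite jE].
have graph_omega i : I' i -> omega_graph tauY I' J' i (omega i).
  move=> I'i; have [Ii hi hwi] := I'i; split=> //; first by exists i.
  (* Both interventions are hard, so condition (S) is the required equality of restriction sets. *)
  by rewrite -!soft_rst_hard //; case: (omegaP i Ii).
split=> //.
- by move=> i [].
- by move=> j [i I'i <-]; exists i; exact: graph_omega.
- move=> i j ij e; have [I'i _ _] := ij; have [Ii _ _] := I'i.
  (* [j] may differ from [omega i], but both are related to [i] by the graph, hence yield the same
     equations. *)
  rewrite sol //; apply: same_equations_solution.
  exact: eqJ' _ _ _ (graph_omega i I'i) ij.
Qed.
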